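(* Let $\mathcal{N}=((R,\vee,\cdot,0,1),(R,\wedge,\ast,1,0),\alpha)$ be a coupled right orthosemiring. Then $$\mathbf{L}(\mathcal{N}):=(R,\vee,\wedge,\alpha,0,1)$$ is an orthomodular lattice.
   Context: An orthomodular lattice is an algebra $\mathcal{L}=(L,\vee,\wedge,',0,1)$ of type $(2,2,1,0,0)$ such that: (i) $(L,\vee,\wedge,0,1)$ is a bounded lattice (with least element $0$ and greatest element $1$); (ii) $x\le y$ implies $x'\ge y'$; (iii) $(x')'=x$; (iv) $x\le y$ implies $y=x\vee(y\wedge x')$. A right near semiring is an algebra $(R,+,\cdot,0,1)$ of type $(2,2,0,0)$ such that: (i) $(R,+,0)$ is a commutative monoid; (ii) $(R,\cdot)$ is a groupoid (a set with a binary operation, not necessarily associative) with two-sided neutral element $1$; (iii) $(x+y)z=xz+yz$ for all $x,y,z\in R$; (iv) $x0=0x=0$ for all $x\in R$. In a tuple $(R,\wedge,\ast,1,0)$ the additive operation is $\wedge$ with neutral element $1$, the multiplicative operation is $\ast$ with neutral element $0$, and the absorbing element in (iv) is $1$. A right near semiring $(R,+,\cdot,0,1)$ is $\vee$-semilattice ordered if there is a join-semilattice operation $\vee$ on $R$ such that $x+y=x\vee y$ and $xy\le y$ for all $x,y\in R$, with respect to the induced order ($x\le y$ iff $x\vee y=y$). It is $\wedge$-semilattice ordered if there is a meet-semilattice operation $\wedge$ on $R$ such that $x+y=x\wedge y$ and $xy\ge y$ for all $x,y\in R$, with respect to the induced order ($x\le y$ iff $x\wedge y=x$). A coupled right orthosemiring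 is an ordered triple $((R,\vee,\cdot,0,1),(R,\wedge,\ast,1,0),\alpha)$ such that: (R1) $(R,\vee,\wedge)$ is a lattice; (R2) $(R,\vee,\cdot,0,1)$ is a $\vee$-semilattice ordered right near semiring; (R3) $(R,\wedge,\ast,1,0)$ is a $\wedge$-semilattice ordered right near semiring; (R4) $\alpha$ is an involutive isomorphism between $(R,\vee,\cdot,0,1)$ and $(R,\wedge,\ast,1,0)$, i.e. $\alpha:R\to R$ satisfies $\alpha(\alpha(x))=x$, $\alpha(x\vee y)=\alpha(x)\wedge\alpha(y)$, $\alpha(xy)=\alpha(x)\ast\alpha(y)$ for all $x,y\in R$, and $\alpha(0)=1$, $\alpha(1)=0$; (R5) $(x\wedge\alpha(y))\vee y=x\ast y$ for all $x,y\in R$; (R6) $y\ast(x\wedge y)=y$ for all $x,y\in R$. *)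

(* Defs.v *)
From mathcomp Require Import all_boot.

Set Implicit Arguments.
Unset Strict Implicit.
Unset Printing Implicit Defensive.

(* Algebras are given by their operations on an arbitrary carrier [R : Type].
   MathComp's order and semiring structures are not used: they require a
   choiceType carrier, and for semirings an associative multiplication. *)

Section Definitions.

Variable R : Type.

Record semilattice (op : R -> R -> R) : Prop := {
  semilattice_assoc : associative op;
  semilattice_comm : commutative op;
  semilattice_idem : idempotent_op op
}.

Definition join_le (join : R -> R -> R) (x y : R) : Prop := join x y = y.

Definition meet_le (meet : R -> R -> R) (x y : R) : Prop := meet x y = x.

Record lattice (join meet : R -> R -> R) : Prop := {
  lattice_join : semilattice join;
  lattice_meet : semilattice meet;
  lattice_joinK : forall x y, join x (meet x y) = x;
  lattice_meetK : forall x y, meet x (join x y) = x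
}.

Record bounded_lattice (join meet : R -> R -> R) (zero one : R) : Prop := {
  bounded_lattice_lattice : lattice join meet;
  bounded_lattice_least : forall x, join_le join zero x;
  bounded_lattice_greatest : forall x, join_le join x one
}.

Record orthomodular_lattice (join meet : R -> R -> R) (compl : R -> R)
    (zero one : R) : Prop := {
  oml_bounded : bounded_lattice join meet zero one;
  oml_antitone :
    forall x y, join_le join x y -> join_le join (compl y) (compl x);
  oml_involutive : involutive compl;
  oml_orthomodular :
    forall x y, join_le join x y -> y = join x (meet y (compl x))
}.

(* [left_distributive mul add] is the right-hand law
   (x + y) z = x z + y z. *)
Record right_near_semiring (add mul : R -> R -> R) (zero one : R) : Prop := {
  rns_addA : associative add;
  rns_addC : commutative add;
  rns_add0 : left_id zero add;
  rns_mul1l : left_id one mul;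
  rns_mul1r : right_id one mul;
  rns_mulDl : left_distributive mul add;
  rns_mul0l : left_zero zero mul;
  rns_mul0r : right_zero zero mul
}.

Record join_ordered_rns (add mul : R -> R -> R) (zero one : R) : Prop := {
  join_ordered_rns_rns : right_near_semiring add mul zero one;
  join_ordered_rns_order : exists join : R -> R -> R,
    [/\ semilattice join,
        forall x y, add x y = join x y &
        forall x y, join_le join (mul x y) y]
}.

Record meet_ordered_rns (add mul : R -> R -> R) (zero one : R) : Prop := {
  meet_ordered_rns_rns : right_near_semiring add mul zero one;
  meet_ordered_rns_order : exists meet : R -> R -> R,
    [/\ semilattice meet,
        forall x y, add x y = meet x y &
        forall x y, meet_le meet y (mul x y)]
}.

(* An isomorphism (R, add1, mul1, zero1, one1) -> (R, add2, mul2, zero2, one2)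
   that is its own inverse as a map; bijectivity follows from involutivity. *)
Record involutive_isomorphism
    (add1 mul1 : R -> R -> R) (zero1 one1 : R)
    (add2 mul2 : R -> R -> R) (zero2 one2 : R) (alpha : R -> R) : Prop := {
  inviso_involutive : involutive alpha;
  inviso_add : {morph alpha : x y / add1 x y >-> add2 x y};
  inviso_mul : {morph alpha : x y / mul1 x y >-> mul2 x y};
  inviso_zero : alpha zero1 = zero2;
  inviso_one : alpha one1 = one2
}.

(* The triple ((R, join, dot, zero, one), (R, meet, ast, one, zero), alpha):
   the second algebra has additive neutral element [one] and multiplicative
   neutral element [zero]. *)
Record coupled_right_orthosemiring (join dot meet ast : R -> R -> R)
    (zero one : R) (alpha : R -> R) : Prop := {
  cros_lattice : lattice join meet;
  cros_join_rns : join_ordered_rns join dot zero one;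
  cros_meet_rns : meet_ordered_rns meet ast one zero;
  cros_iso : involutive_isomorphism join dot zero one meet ast one zero alpha;
  cros_ast : forall x y, join (meet x (alpha y)) y = ast x y;
  cros_ast_meet : forall x y, ast y (meet x y) = y
}.

End Definitions.

(* Main.v *)
(** For [x <= y], (R6) gives [y * x = y * (x /\ y) = y], and (R5) expands
    [y * x] to [(y /\ alpha x) \/ x]: this is the orthomodular law. *)

Require Import Defs.
From mathcomp Require Import all_boot.

(** Besides the orthomodular law, what needs an argument follows by absorption: [one], neutral for
    [meet], is the top, and [alpha], turning joins into meets, reverses the order. *)

Theorem theorem10 (R : Type) (join dot meet ast : R -> R -> R) (zero one : R)
    (alpha : R -> R) :
  coupled_right_orthosemiring join dot meet ast zero one alpha ->
  orthomodular_lattice join meet alpha zero one.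
Proof.
case=> lat [[_ _ join0x _ _ _ _ _] _] [[_ _ meet1x _ _ _ _ _] _].
case=> alphaK alphaU _ _ _ astE ast_meet.
have [[_ joinC _] [_ meetC _] joinK meetK] := lat.
split=> //.
- split=> // x; rewrite /join_le.
  by rewrite joinC -{1}(meet1x x) joinK.
- move=> x y xy; rewrite /join_le.
  (* Reading [y] as [join x y] makes [alpha y] a meet with [alpha x], hence absorbed. *)
  by rewrite -{1}xy alphaU joinC joinK.
- move=> x y xy.
  have meet_xy : meet x y = x by rewrite -xy meetK.
  (* Only the left-hand [y] is expanded, so both sides become [ast y x]. *)
  by rewrite joinC astE -{1}(ast_meet x y) meet_xy.
Qed.
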